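(* The preLie product $\vartriangleleft$ restricts to the linear space $\mathfrak m_{\mathsf I}$, i.e. $f\vartriangleleft g\in\mathfrak m_{\mathsf I}$ for all $f,g\in\mathfrak m_{\mathsf I}$. Furthermore, for every translucent word $t$, every incomplete word $w\in\mathcal W(t)$ with $|\mathrm{int}(w)|=1$ and all $f,g\in\mathfrak m_{\mathsf I}$, $$(f\vartriangleleft g)(w)=\sum_{\substack{I_1,I_2,J\subset[t]_1,\ I_1,I_2\neq\varnothing\\ I_1\lessdot J\lessdot I_2\ \lessdot\text{-intervals}\\ I_1\sqcup J\sqcup I_2=[t]_1}}f(w|_{I_1\cup I_2})\,g(w|_J),$$ where $I_1\lessdot J\lessdot I_2$ means that all elements of $I_1$ precede all elements of $J$, which precede all elements of $I_2$, in the necklace order.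
   Context: Write $\llbracket n\rrbracket=\{1,\dots,n\}$; $A\subset B$ allows equality. For a word $w$ of length $|w|$ and $A=\{i_1<\dots<i_p\}\subset\llbracket|w|\rrbracket$, $w|_A=w(i_1)\cdots w(i_p)$. Translucent words. A translucent word is a pair $t=(\alpha_t,b_t)$ of words of equal length $|t|\ge0$, $\alpha_t\in\{\mathsf L,\mathsf R\}^\star$, $b_t\in\{0,1\}^\star$. Put $[t]_0=\{i:b_t(i)=0\}$, $[t]_1=\{i:b_t(i)=1\}$, $t(i)=(\alpha_t(i),b_t(i))$. The necklace order $\lessdot$ on $\llbracket|t|\rrbracket$ is the total order in which all $\mathsf L$-positions precede all $\mathsf R$-positions, the $\mathsf L$-positions being ordered increasingly and the $\mathsf R$-positions decreasingly; a $\lessdot$-interval is an interval of $(\llbracket|t|\rrbracket,\lessdot)$. For nonempty $A$, $\dot\bigwedge A$ is its $\lessdot$-minimum. $\mathrm{int}(t)$ is the set of maximal (nonempty) $\lessdot$-intervals contained in $[t]_1$. Incomplete words. Fix finite sets $\dot S^{\mathsf L},\dot S^{\mathsf R}$ of left and right random variables (finite subsets of two subalgebras of a unital complex algebra, treated as disjoint and disjoint from the placeholder symbols $\mathsf L,\mathsf R$). Put $S^{(\mathsf L,0)}=\{\mathsf L\}$, $S^{(\mathsf R,0)}=\{\mathsf R\}$, $S^{(\mathsf L,1)}=\dot S^{\mathsf L}$, $S^{(\mathsf R,1)}=\dot S^{\mathsf R}$, and $\mathcal W(t)=S^{t(1)}\times\cdots\times S^{t(|t|)}$; elements are incomplete words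 of type $t$. For $w\in\mathcal W(t)$ put $[w]_i=[t]_i$, $\mathrm{int}(w)=\mathrm{int}(t)$; the translucidation $w_{I\leadsto0}$ ($I\subset\llbracket|w|\rrbracket$) is obtained by replacing $w(j)$ by the placeholder $\alpha_t(j)$ for every $j\in I$. A linear form on $\mathbb C\mathcal W$ is a linear functional on $\bigoplus_t\mathbb C\mathcal W(t)$, i.e. is given by arbitrary values on incomplete words. PreLie product. $\mathfrak g$ is the space of linear forms on $\mathbb C\mathcal W$ vanishing on words in $\{\mathsf L,\mathsf R\}^\star$ (only placeholders). For $f,g\in\mathfrak g$, the linear forms $f\prec g,f\succ g\in\mathfrak g$ are, for $[w]_1\neq\varnothing$, $$(f\prec g)(w)=\sum_{\substack{[w]_0\subsetneq I\subsetneq\llbracket|w|\rrbracket\\ \dot\bigwedge[w]_1\in I}}f(w|_I)g(w_{I\leadsto0}),\qquad(f\succ g)(w)=\sum_{\substack{[w]_0\subsetneq I\subsetneq\llbracket|w|\rrbracket\\ \dot\bigwedge[w]_1\notin I}}f(w|_I)g(w_{I\leadsto0}),$$ and $f\vartriangleleft g=f\prec g-g\succ f$. $\mathfrak m_{\mathsf I}\subset\mathfrak g$ is the set of linear forms $f$ on $\mathbb C\mathcal W$ such that $f(w)=0$ whenever $|\mathrm{int}(w)|\ne1$, and $f(w)=f(w|_{[w]_1})$ whenever $|\mathrm{int}(w)|=1$. *)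

(* Defs.v *)
From HB Require Import structures.
From mathcomp Require Import all_boot all_order all_algebra.
From mathcomp Require Import complex reals.

Set Implicit Arguments.
Unset Strict Implicit.
Unset Printing Implicit Defensive.

Import GRing.Theory.

Local Open Scope ring_scope.

(* The positions 1, ..., n of a word of length n are represented by 'I_n, so
   they are shifted down by one; only their order matters. *)

(* w|_A; enum A lists A increasingly. *)
Definition subword (T : Type) (n : nat) (w : n.-tuple T) (A : {set 'I_n}) :
  seq T := [seq tnth w i | i <- enum A].

Inductive side : Type := L | R.

(* Translucent words of length n: pairs (alpha_t, b_t), with 0 = false. *)
Definition translucent (n : nat) : Type := (n.-tuple side * n.-tuple bool)%type.

Section Translucent.
Variables (n : nat) (t : translucent n).
Implicit Types (i j : 'I_n) (A B K I J : {set 'I_n}).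

Definition cell i : side * bool := (tnth t.1 i, tnth t.2 i).

Definition zeros : {set 'I_n} := [set i | ~~ tnth t.2 i].
Definition ones : {set 'I_n} := [set i | tnth t.2 i].

(* The reflexive necklace order. *)
Definition nle i j : bool :=
  match tnth t.1 i, tnth t.1 j with
  | L, L => (i <= j)%N
  | L, R => true
  | R, L => false
  | R, R => (j <= i)%N
  end.

Definition nlt i j : bool := (i != j) && nle i j.

Lemma nle_refl : reflexive nle.
Proof. by move=> i; rewrite /nle; case: (tnth t.1 i). Qed.

Lemma nle_anti : antisymmetric nle.
Proof.
move=> i j; rewrite /nle.
case: (tnth t.1 i); case: (tnth t.1 j) => //; rewrite -eqn_leq => /eqP e;
  exact: val_inj.
Qed.

Lemma nle_trans : transitive nle.
Proof.
move=> j i k; rewrite /nle.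
case: (tnth t.1 i); case: (tnth t.1 j); case: (tnth t.1 k) => // h1 h2;
  [exact: leq_trans h1 h2 | exact: leq_trans h2 h1].
Qed.

Lemma nle_total : total nle.
Proof.
move=> i j; rewrite /nle.
by case: (tnth t.1 i); case: (tnth t.1 j) => //; exact: leq_total.
Qed.

(* Intervals of the necklace order; the empty set is one. *)
Definition ninterval A : bool :=
  [forall i in A, forall k in A, forall j, (nle i j && nle j k) ==> (j \in A)].

(* The minimum of A, or None when A is empty. *)
Definition nmin A : option 'I_n := [pick i in A | [forall j in A, nle i j]].

(* int(t) *)
Definition int_of : {set {set 'I_n}} :=
  [set K | maxset [pred A : {set 'I_n} |
                     [&& A != set0, ninterval A & A \subset ones]] K].

(* All elements of A precede all elements of B. *)
Definition nprec A B : bool := [forall i in A, forall j in B, nlt i j].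

(* The index triples of the explicit formula. *)
Definition ones_split I1 J I2 : bool :=
  [&& [&& I1 \subset ones, J \subset ones & I2 \subset ones],
      (I1 != set0) && (I2 != set0),
      [&& ninterval I1, ninterval J & ninterval I2],
      nprec I1 J && nprec J I2,
      [&& [disjoint I1 & J], [disjoint J & I2] & [disjoint I1 & I2]]
    & I1 :|: J :|: I2 == ones].

End Translucent.

Section IncompleteWords.
(* SL and SR are the finite sets of left and right random variables.  The
   ambient algebra plays no role: they serve only as disjoint alphabets. *)
Variables (SL SR : finType).

Inductive letter : Type :=
  | Placeholder of side
  | LeftVar of SL
  | RightVar of SR.

(* S^x for x in {L, R} x {0, 1}. *)
Definition alphabet (x : side * bool) (l : letter) : bool :=
  match x, l with
  | (L, false), Placeholder L => true
  | (R, false), Placeholder R => true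
  | (L, true), LeftVar _ => true
  | (R, true), RightVar _ => true
  | _, _ => false
  end.

(* w \in W(t) *)
Definition incomplete n (t : translucent n) (w : n.-tuple letter) : Prop :=
  forall i, alphabet (cell t i) (tnth w i).

(* The four alphabets are disjoint and exhaust the letters, so every tuple of
   letters is an incomplete word of a unique type, which wtype computes. *)
Definition letter_side (l : letter) : side :=
  match l with Placeholder s => s | LeftVar _ => L | RightVar _ => R end.

Definition letter_bit (l : letter) : bool :=
  if l is Placeholder _ then false else true.

Definition wtype n (w : n.-tuple letter) : translucent n :=
  ([tuple letter_side (tnth w i) | i < n],
   [tuple letter_bit (tnth w i) | i < n]).

Lemma incompleteE n (t : translucent n) (w : n.-tuple letter) :
  incomplete t w <-> wtype w = t.
Proof.
split=> [wt | <- i]; last first.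
  by rewrite /cell !tnth_mktuple; case: (tnth w i) => [[]||].
case: t wt => a b wt; congr (_, _); apply: eq_from_tnth => i;
  move: (wt i); rewrite tnth_mktuple /cell /=;
  by case: (tnth a i); case: (tnth b i); case: (tnth w i) => [[]||].
Qed.

(* w_{I ~> 0} *)
Definition translucidate n (w : n.-tuple letter) (I : {set 'I_n}) :
    n.-tuple letter :=
  [tuple if i \in I then Placeholder (letter_side (tnth w i)) else tnth w i
    | i < n].

Variable (F : realType).

(* Linear forms on C W, given by their values on the basis of incomplete
   words of all types, that is, on all sequences of letters. *)
Definition linear_form : Type := seq letter -> F[i].
Implicit Types (f g : linear_form).

Definition is_placeholder (l : letter) : bool :=
  if l is Placeholder _ then true else false.

Definition in_g f : Prop :=
  forall w : seq letter, all is_placeholder w -> f w = 0.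

(* Elements of g vanish when [w]_1 is empty, hence the None branches. *)
Definition lprec f g : linear_form := fun w0 =>
  let w := in_tuple w0 in
  let t := wtype w in
  if nmin t (ones t) is Some m then
    \sum_(I : {set 'I_(size w0)} |
            [&& zeros t \proper I, I \proper [set: 'I_(size w0)] & m \in I])
      f (subword w I) * g (translucidate w I)
  else 0.

Definition lsucc f g : linear_form := fun w0 =>
  let w := in_tuple w0 in
  let t := wtype w in
  if nmin t (ones t) is Some m then
    \sum_(I : {set 'I_(size w0)} |
            [&& zeros t \proper I, I \proper [set: 'I_(size w0)] & m \notin I])
      f (subword w I) * g (translucidate w I)
  else 0.

Definition prelie f g : linear_form := fun w => lprec f g w - lsucc g f w.

(* m_I *)
Definition in_mI f : Prop :=
  [/\ in_g f,
      forall n (w : n.-tuple letter), #|int_of (wtype w)| <> 1%N -> f w = 0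
    & forall n (w : n.-tuple letter), #|int_of (wtype w)| = 1%N ->
        f w = f (subword w (ones (wtype w)))].

Lemma in_mI0 : in_mI (fun=> 0).
Proof. by []. Qed.

Lemma in_mI_linear (a : F[i]) f g :
  in_mI f -> in_mI g -> in_mI (fun w => a * f w + g w).
Proof.
move=> [f1 f2 f3] [g1 g2 g3]; split=> [w hw|n w hw|n w hw].
- by rewrite f1 // g1 // mulr0 addr0.
- by rewrite f2 // g2 // mulr0 addr0.
- by rewrite f3 // g3.
Qed.

End IncompleteWords.

(* Main.v *)
Require Import Defs.
From mathcomp Require Import all_boot all_order all_algebra.
From mathcomp Require Import complex reals.
From mathcomp Require Import zify.

Set Implicit Arguments.
Unset Strict Implicit.
Unset Printing Implicit Defensive.

Import GRing.Theory.

Local Open Scope ring_scope.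

(** Let O and Z be the sets of ones and zeros of the type of w, and let m be
the necklace minimum of O.  The sets I summed over in the products are the
Z :|: A with A a nonempty proper subset of O.  For f and g in m_I, the value
f (w|_I) is f (w|_A) if no element of I outside A lies between elements of A,
and 0 otherwise; the value g (w_{I ~> 0}) is g (w|_(O :\: A)) if O :\: A is an
interval, and 0 otherwise.  Replacing A by O :\: A in the second product then
gives [prelie_sum]: the preLie product is the sum over the proper subsets A of
O containing m of f (w|_A) * g (w|_(O :\: A)), with coefficient
[A convex in Z :|: A][O :\: A interval]
- [O :\: A convex in Z :|: (O :\: A)][A interval].

If O is not an interval, some zero z lies between two ones.  When both
conditions of one bracket hold, each of A and O :\: A lies on a single side
of z, hence they lie on opposite sides, and the conditions of the other
bracket hold as well.  All coefficients vanish ([gap_convexE], [prelie_gap]).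

If O is a nonempty interval, no zero lies between ones, and the coefficient is
[O :\: A interval] - [A interval].  An interval A containing m is initial in
O, so its complement in O is again an interval.  What remains is the sum over
the intervals J included in O whose complement O :\: J is not an interval
([prelie_interval]); the condition m \notin J need not be imposed, since an
interval J containing m has an interval as complement.  This sum only involves
the order induced on O, so it is the same for w and w|_O: this is the
invariance required by m_I.  Finally, the complement of J fails to be an
interval exactly when J is nonempty with elements of O on both sides, and then
I1 and I2 are the parts of O before and after J ([prelie_triples]).  The
triples with J empty contribute 0, because g vanishes on the empty word. *)

(** * Convexity in the necklace order *)

Section Order.
Variables (n : nat) (t : translucent n).
Implicit Types (i j k m : 'I_n) (A B I J O : {set 'I_n}).

(** The necklace order is the order of these ranks: the L-positions have ranks
below n and the R-positions have decreasing ranks above n. *)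
Definition nrank i : nat :=
  if tnth t.1 i is L then i else ((n + n) - i)%N.

Lemma nleE i j : nle t i j = (nrank i <= nrank j)%N.
Proof.
rewrite /nle /nrank; have := ltn_ord i; have := ltn_ord j.
by case: (tnth t.1 i); case: (tnth t.1 j) => //=; lia.
Qed.

Lemma nrank_inj : injective nrank.
Proof. by move=> i j e; apply: (@nle_anti n t); rewrite !nleE e leqnn. Qed.

Lemma nltE i j : nlt t i j = (nrank i < nrank j)%N.
Proof. by rewrite /nlt nleE ltn_neqAle (inj_eq nrank_inj). Qed.

(** Every element of I between two elements of A is in A.  For A included in
I, this says that A is an interval of I with the induced order. *)
Definition nconvex I A : bool :=
  [forall i in A, forall k in A, forall j in I,
     (nle t i j && nle t j k) ==> (j \in A)].

Lemma nconvexP I A :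
  reflect (forall i j k, i \in A -> k \in A -> j \in I ->
             (nrank i <= nrank j)%N -> (nrank j <= nrank k)%N -> j \in A)
          (nconvex I A).
Proof.
apply: (iffP forall_inP) => [h i j k iA kA jI ij jk | h i iA].
  have /forall_inP/(_ k kA)/forall_inP/(_ j jI)/implyP := h i iA.
  by rewrite !nleE; apply; rewrite ij jk.
apply/forall_inP => k kA; apply/forall_inP => j jI.
by rewrite !nleE; apply/implyP => /andP[]; apply: h.
Qed.

Lemma nintervalE A : ninterval t A = nconvex setT A.
Proof.
apply: eq_forallb_in => i _; apply: eq_forallb_in => k _.
by apply: eq_forallb => j; rewrite inE.
Qed.

Lemma nconvexN I A :
  ~~ nconvex I A ->
  exists i j k, [/\ i \in A, k \in A, j \in I, j \notin A &
                    (nrank i <= nrank j <= nrank k)%N].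
Proof.
case/forall_inPn => i iA /forall_inPn[k kA] /forall_inPn[j jI].
by rewrite negb_imply !nleE => /andP[? ?]; exists i, j, k.
Qed.

Lemma nconvexS I J A : I \subset J -> nconvex J A -> nconvex I A.
Proof.
move=> /subsetP IJ /nconvexP h; apply/nconvexP => i j k iA kA /IJ; exact: h.
Qed.

Lemma nconvex_setT O A :
  A \subset O -> nconvex setT O -> nconvex setT A = nconvex O A.
Proof.
move=> /subsetP AO /nconvexP cO; apply/idP/idP => [|/nconvexP h].
  by apply: nconvexS; exact: subsetT.
apply/nconvexP => i j k iA kA _ ij jk; apply: (h i j k) => //.
by apply: (cO i j k); rewrite ?AO ?inE.
Qed.

Lemma nconvex0 I : nconvex I set0.
Proof. by apply/nconvexP => i j k; rewrite inE. Qed.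

Lemma in_onesN i : (i \in zeros t) = (i \notin ones t).
Proof. by rewrite !inE. Qed.

(** There is exactly one maximal interval of ones exactly when the ones form a
nonempty interval: every singleton of a one extends to a maximal interval. *)
Lemma card_int_of :
  #|int_of t| = 1%N <-> ones t != set0 /\ nconvex setT (ones t).
Proof.
set P := [pred A : {set 'I_n} |
           [&& A != set0, ninterval t A & A \subset ones t]].
have intP K : (K \in int_of t) = maxset P K by rewrite inE.
split=> [/eqP/cards1P[K eK] | [O0 cO]].
  have /maxsetP[/and3P[K0 cK KO] _] : maxset P K by rewrite -intP eK set11.
  suff OK : ones t \subset K.
    have <- : K = ones t by apply/eqP; rewrite eqEsubset KO.
    by rewrite -nintervalE.
  apply/subsetP => i iO.
  have Pi : P [set i].
    apply/and3P; split; last by rewrite sub1set.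
      by apply/set0Pn; exists i; rewrite set11.
    rewrite nintervalE; apply/nconvexP => a b c /set1P-> /set1P-> _ h1 h2.
    by apply/set1P/nrank_inj/eqP; rewrite eqn_leq h1 h2.
  have [K' mK' ] := maxset_exists Pi.
  have : K' \in int_of t by rewrite intP.
  by rewrite eK => /set1P->; rewrite sub1set.
suff -> : int_of t = [set ones t] by rewrite cards1.
have PO : P (ones t) by rewrite /P /= O0 nintervalE cO subxx.
apply/setP => K; rewrite intP inE; apply/idP/eqP => [|->].
  by case/maxsetP => /and3P[_ _ KO] /(_ _ PO KO).
by apply/maxsetP; split=> // B /and3P[_ _ BO] OB; apply/eqP; rewrite eqEsubset BO.
Qed.

(** A zero z between two ones separates A from B: neither of them has elements
on both sides of z, so no element of B lies between elements of A. *)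
Lemma gap_convex A B :
  [disjoint A & B] -> A :|: B = ones t -> ~~ nconvex setT (ones t) ->
  nconvex (zeros t :|: A) A -> nconvex setT B ->
  nconvex setT A.
Proof.
move=> dAB eO /nconvexN[x [z [y [xO yO _ zO /andP[xz zy]]]]].
move=> /nconvexP PA /nconvexP QB.
have zA : z \notin A by apply: contra zO => h; rewrite -eO inE h.
have zB : z \notin B by apply: contra zO => h; rewrite -eO inE h orbT.
have noA a c : a \in A -> c \in A ->
    (nrank a <= nrank z)%N -> (nrank z <= nrank c)%N -> False.
  move=> aA cA h1 h2; move: zA; rewrite (PA a z c) // inE in_onesN zO //.
have noB a c : a \in B -> c \in B ->
    (nrank a <= nrank z)%N -> (nrank z <= nrank c)%N -> False.
  by move=> aB cB h1 h2; move: zB; rewrite (QB a z c) // inE.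
apply/nconvexP => i j k iA kA _ ij jk.
have [jO|jZ] := boolP (j \in ones t); last first.
  by apply: (PA i j k) => //; rewrite inE in_onesN jZ.
move: jO; rewrite -eO => /setUP[//|jB]; exfalso.
move: xO yO; rewrite -eO => /setUP[xA|xB] /setUP[yA|yB].
- exact: (noA x y).
- have [jz|zj] := leqP (nrank j) (nrank z); first exact: (noB j y).
  by apply: (noA x k) => //; exact: leq_trans (ltnW zj) jk.
- have [zj|jz] := leqP (nrank z) (nrank j); first exact: (noB x j).
  by apply: (noA i y) => //; exact: leq_trans ij (ltnW jz).
- exact: (noB x y).
Qed.

Lemma gap_convexE A :
  A \subset ones t -> ~~ nconvex setT (ones t) ->
  nconvex (zeros t :|: A) A && nconvex setT (ones t :\: A) =
  nconvex (zeros t :|: (ones t :\: A)) (ones t :\: A) && nconvex setT A.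
Proof.
move=> AO nO; set B := ones t :\: A.
have dAB : [disjoint A & B].
  by rewrite disjoints_subset; apply/subsetP=> i; rewrite !inE => ->.
have eO : A :|: B = ones t by rewrite /B setDE setUIr setUCr setIT; apply/setUidPr.
apply/idP/idP => /andP[P Q]; rewrite ?(nconvexS (subsetT _) Q) /=.
  exact: gap_convex dAB eO nO P Q.
by rewrite disjoint_sym in dAB; rewrite setUC in eO; apply: gap_convex dAB eO nO P Q.
Qed.

Lemma nconvex_zerosU A :
  A \subset ones t -> nconvex setT (ones t) -> nconvex (zeros t :|: A) A.
Proof.
move=> /subsetP AO /nconvexP cO.
apply/nconvexP => i j k iA kA /setUP[|//] jZ ij jk; move: jZ.
by rewrite in_onesN (cO i j k) // ?AO ?inE.
Qed.

(** An interval containing the minimum of an interval O is initial in O, so the rest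
of O is an interval. *)
Lemma nconvex_compl O A m :
  nconvex setT O -> (forall i, i \in O -> (nrank m <= nrank i)%N) -> m \in A ->
  nconvex setT A -> nconvex setT (O :\: A).
Proof.
move=> /nconvexP cO mO mA /nconvexP cA; apply/nconvexP => i j k.
rewrite !inE => /andP[iA iO] /andP[kA kO] _ ij jk.
rewrite (cO i j k) // ?inE // andbT; apply: contra iA => jA.
by apply: (cA m i j) => //; rewrite ?inE ?mO.
Qed.

(** The elements of O that precede, resp. follow, all elements of J. *)
Definition before O J := [set i in O | [forall j in J, nlt t i j]].
Definition after O J := [set i in O | [forall j in J, nlt t j i]].

Lemma beforeP O J i :
  reflect (i \in O /\ forall j, j \in J -> (nrank i < nrank j)%N)
          (i \in before O J).
Proof.
rewrite inE; apply: (iffP andP) => -[iO h]; split=> //.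
  by move=> j jJ; rewrite -nltE; apply: (forall_inP h).
by apply/forall_inP => j jJ; rewrite nltE h.
Qed.

Lemma afterP O J i :
  reflect (i \in O /\ forall j, j \in J -> (nrank j < nrank i)%N)
          (i \in after O J).
Proof.
rewrite inE; apply: (iffP andP) => -[iO h]; split=> //.
  by move=> j jJ; rewrite -nltE; apply: (forall_inP h).
by apply/forall_inP => j jJ; rewrite nltE h.
Qed.

Lemma nprecP A B :
  reflect (forall i j, i \in A -> j \in B -> (nrank i < nrank j)%N)
          (nprec t A B).
Proof.
apply: (iffP forall_inP) => [h i j iA jB|h i iA].
  by rewrite -nltE; apply: (forall_inP (h i iA)).
by apply/forall_inP => j jB; rewrite nltE h.
Qed.

Lemma nprec_disjoint A B : nprec t A B -> [disjoint A & B].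
Proof.
move=> /nprecP h; rewrite disjoints_subset; apply/subsetP=> i iA; rewrite inE.
by apply/negP => iB; have := h i i iA iB; rewrite ltnn.
Qed.

(** The middle set of a triple determines the two others, unless it is empty. *)
Lemma ones_split_eq I1 J I2 :
  ones_split t I1 J I2 -> J != set0 ->
  I1 = before (ones t) J /\ I2 = after (ones t) J.
Proof.
case/and5P=> /and3P[/subsetP s1 _ /subsetP s2] _ _ /andP[/nprecP p1 /nprecP p2].
case/andP => _ /eqP eO /set0Pn[j jJ].
split; apply/setP => i.
  apply/idP/beforeP => [iI|[]]; first by split=> [|k kJ]; [exact: s1|exact: p1].
  rewrite -eO => /setUP[/setUP[//|iJ]|iI] h; first by have := h i iJ; rewrite ltnn.
  by have := ltn_trans (h j jJ) (p2 j i jJ iI); rewrite ltnn.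
apply/idP/afterP => [iI|[]]; first by split=> [|k kJ]; [exact: s2|exact: p2].
rewrite -eO => /setUP[/setUP[iI|iJ]|//] h; last by have := h i iJ; rewrite ltnn.
by have := ltn_trans (h j jJ) (p1 i j iI jJ); rewrite ltnn.
Qed.

Lemma ones_split_before_after J :
  nconvex setT (ones t) ->
  ones_split t (before (ones t) J) J (after (ones t) J) && (J != set0) =
  [&& J \subset ones t, nconvex setT J & ~~ nconvex setT (ones t :\: J)].
Proof.
move=> cO'; have /nconvexP cO := cO'; apply/idP/idP.
  case/andP=> sp /set0Pn[j jJ].
  case/and5P: sp => /and3P[_ JO _] /andP[/set0Pn[i iI] /set0Pn[k kI]].
  rewrite !nintervalE => /and3P[_ cJ _] _ _.
  rewrite JO cJ /=; apply/negP => /nconvexP/(_ i j k).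
  case/beforeP: iI => iO ij; case/afterP: kI => kO jk.
  rewrite !in_setD jJ iO kO !andbT /= => cC.
  suff: false by [].
  apply: cC.
  - by apply/negP => /ij; rewrite ltnn.
  - by apply/negP => /jk; rewrite ltnn.
  - exact: in_setT.
  - exact: ltnW (ij _ jJ).
  - exact: ltnW (jk _ jJ).
case/and3P => JO /nconvexP cJ /nconvexN[i [j [k []]]].
rewrite !in_setD => /andP[iJ iO] /andP[kJ kO] _ jN /andP[ij jk].
have jO : j \in ones t by apply: (cO i j k); rewrite ?in_setT.
have jJ : j \in J by apply: contraR jN => ->.
(* By convexity of J, its element j decides on which side of J a lies. *)
have tri a : a \in ones t -> a \notin J ->
    if (nrank a < nrank j)%N then a \in before (ones t) J
    else a \in after (ones t) J.
  move=> aO aJ; case: ltnP => [aj|ja].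
    apply/beforeP; split=> // b bJ; rewrite ltnNge; apply: contra aJ => ba.
    by apply: (cJ b a j); rewrite ?in_setT // ltnW.
  apply/afterP; split=> // b bJ; rewrite ltnNge; apply: contra aJ => ba.
  by apply: (cJ j a b); rewrite ?in_setT.
have sb : before (ones t) J \subset ones t by apply/subsetP => a /beforeP[].
have sa : after (ones t) J \subset ones t by apply/subsetP => a /afterP[].
have p1 : nprec t (before (ones t) J) J.
  by apply/nprecP => a b /beforeP[_ h]; apply: h.
have p2 : nprec t J (after (ones t) J).
  by apply/nprecP => a b aJ /afterP[_ h]; apply: h.
have p3 : nprec t (before (ones t) J) (after (ones t) J).
  apply/nprecP => a b /beforeP[_ /(_ _ jJ) h1] /afterP[_ /(_ _ jJ)].
  exact: ltn_trans.
rewrite andbC; apply/andP; split; first by apply/set0Pn; exists j.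
apply/and5P; split; rewrite ?sb ?sa ?JO ?p1 ?p2 //.
- apply/andP; split; apply/set0Pn; [exists i|exists k].
    have := tri i iO iJ; case: ltnP => // ji.
    have /nrank_inj e : nrank i = nrank j by apply/eqP; rewrite eqn_leq ij ji.
    by rewrite e jJ in iJ.
  have := tri k kO kJ; case: ltnP => // kj.
  by rewrite ltnNge jk in kj.
- rewrite !nintervalE; apply/and3P; split.
  + apply/nconvexP => a b c /beforeP[aO _] /beforeP[cO1 hc] _ ab bc.
    apply/beforeP; split; first by apply: (cO a b c); rewrite ?in_setT.
    by move=> d /hc; apply: leq_ltn_trans.
  + exact/nconvexP.
  + apply/nconvexP => a b c /afterP[aO ha] /afterP[cO1 _] _ ab bc.
    apply/afterP; split; first by apply: (cO a b c); rewrite ?in_setT.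
    by move=> d /ha h; apply: leq_trans h ab.
- rewrite !nprec_disjoint //=; apply/eqP/setP => a.
  apply/idP/idP => [|aO].
    by move=> /setUP[/setUP[/(subsetP sb)|/(subsetP JO)]|/(subsetP sa)].
  have [aJ|aJ] := boolP (a \in J); first by rewrite !in_setU aJ orbT.
  by have := tri a aO aJ; case: ltnP => _ h; rewrite !in_setU h ?orbT.
Qed.

Lemma nmin_spec :
  if nmin t (ones t) is Some m
  then m \in ones t /\ forall i, i \in ones t -> (nrank m <= nrank i)%N
  else ones t = set0.
Proof.
rewrite /nmin; case: pickP => [m /andP[mO /forall_inP h]|h].
  by split=> // i /h; rewrite nleE.
apply/eqP; apply/negPn/negP => /set0Pn[i0 i0O].
have [m mO hm] := arg_minnP nrank i0O.
have {}mO : m \in ones t := mO.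
have := h m; rewrite mO /=; case/negbT/forall_inPn => i /hm.
by rewrite nleE => ->.
Qed.

End Order.

(** * Increasing maps between positions *)

Section Increasing.
Variables (m n : nat) (h : 'I_m -> 'I_n).
Hypothesis h_incr : {homo h : i j / (i < j)%N}.

Lemma incr_inj : injective h.
Proof.
move=> i j e; case: (ltngtP i j) => [lt|lt|/val_inj//].
  by have := h_incr lt; rewrite e ltnn.
by have := h_incr lt; rewrite e ltnn.
Qed.

Lemma incr_leE i j : (h i <= h j)%N = (i <= j)%N.
Proof.
case: (ltngtP i j) => [/h_incr/ltnW//|/h_incr|/val_inj->]; last exact: leqnn.
by rewrite ltnNge => /negbTE.
Qed.

End Increasing.

Lemma sorted_enum p (B : {set 'I_p}) :
  sorted (fun i j : 'I_p => i < j)%N (enum B).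
Proof.
have tr : transitive (fun i j : 'I_p => i < j)%N by move=> ? ? ?; apply: ltn_trans.
rewrite {1}/enum_mem; apply: sorted_filter => //.
have : sorted ltn [seq val i | i <- enum 'I_p].
  by rewrite val_enum_ord; exact: iota_ltn_sorted.
by rewrite sorted_map enumT.
Qed.

Lemma enum_imset m n (h : 'I_m -> 'I_n) (B : {set 'I_m}) :
  {homo h : i j / (i < j)%N} -> enum (h @: B) = map h (enum B).
Proof.
move=> h_incr; apply: (@irr_sorted_eq _ (fun i j : 'I_n => i < j)%N).
- by move=> ? ? ?; apply: ltn_trans.
- by move=> ?; apply: ltnn.
- exact: sorted_enum.
- apply: (homo_sorted (e := fun i j : 'I_m => i < j)%N) => //.
  exact: sorted_enum.
move=> i; rewrite mem_enum; apply/imsetP/mapP => -[j jB ->]; exists j => //;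
  by rewrite mem_enum in jB *.
Qed.

Lemma enum_val_incr n (I : {set 'I_n}) :
  {homo (@enum_val _ (mem I)) : i j / (i < j)%N}.
Proof.
move=> i j ij; have x0 : 'I_n := enum_val i.
rewrite !(enum_val_nth x0).
apply: (sorted_ltn_nth _ _ (sorted_enum I)) => //.
- by move=> ? ? ?; apply: ltn_trans.
- by rewrite inE -cardE.
- by rewrite inE -cardE.
Qed.

(** * Subwords and translucidations *)

Section Words.
Variables (SL SR : finType).
Notation letter := (letter SL SR).

(** The word w o h. *)
Definition comp_word m n (w : n.-tuple letter) (h : 'I_m -> 'I_n) :
  m.-tuple letter := [tuple tnth w (h i) | i < m].

Section Comp.
Variables (m n : nat) (w : n.-tuple letter) (h : 'I_m -> 'I_n).
Hypothesis h_incr : {homo h : i j / (i < j)%N}.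

Lemma nle_comp i j :
  nle (wtype (comp_word w h)) i j = nle (wtype w) (h i) (h j).
Proof. by rewrite /nle !tnth_mktuple !incr_leE. Qed.

Lemma ones_comp : ones (wtype (comp_word w h)) = h @^-1: ones (wtype w).
Proof. by apply/setP=> i; rewrite !inE !tnth_mktuple. Qed.

Lemma nconvex_comp I A :
  nconvex (wtype (comp_word w h)) I A = nconvex (wtype w) (h @: I) (h @: A).
Proof.
have hI := incr_inj h_incr.
apply/forall_inP/forall_inP => c.
  move=> _ /imsetP[i iA ->]; apply/forall_inP => _ /imsetP[k kA ->].
  apply/forall_inP => _ /imsetP[j jI ->].
  rewrite mem_imset // -!nle_comp.
  exact: (forall_inP (forall_inP (c i iA) k kA) j jI).
move=> i iA; apply/forall_inP => k kA; apply/forall_inP => j jI.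
have := c _ (imset_f h iA) => /forall_inP/(_ _ (imset_f h kA)).
by move=> /forall_inP/(_ _ (imset_f h jI)); rewrite mem_imset // -!nle_comp.
Qed.

Lemma subword_comp B : subword (comp_word w h) B = subword w (h @: B).
Proof.
rewrite /subword enum_imset // -map_comp; apply: eq_map => i /=.
by rewrite tnth_mktuple.
Qed.

End Comp.

(** The subword w|_I as a tuple, so that it has a type: its k-th letter is the
letter of w at the k-th element of I. *)
Definition subtuple n (w : n.-tuple letter) (I : {set 'I_n}) :=
  comp_word w (@enum_val _ (mem I)).

Section Subtuple.
Variables (n : nat) (w : n.-tuple letter).
Implicit Types (A B I J : {set 'I_n}).

Lemma imset_enum_valK I A :
  A \subset I -> enum_val @: (@enum_val _ (mem I) @^-1: A) = A.
Proof.
move=> /subsetP AI; apply/setP => i; apply/imsetP/idP => [[k kA ->]|iA].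
  by rewrite inE in kA.
exists (enum_rank_in (AI _ iA) i); last by rewrite enum_rankK_in ?AI.
by rewrite inE enum_rankK_in ?AI.
Qed.

Lemma imset_enum_val I : @enum_val _ (mem I) @: setT = I.
Proof.
suff <- : @enum_val _ (mem I) @^-1: I = setT by rewrite imset_enum_valK.
by apply/setP => k; rewrite !inE enum_valP.
Qed.

Lemma subword_subtuple I (B : {set 'I_#|I|}) :
  subword (subtuple w I) B = subword w (enum_val @: B).
Proof. exact/subword_comp/enum_val_incr. Qed.

Lemma subword_setT p (v : p.-tuple letter) : subword v setT = v.
Proof.
by rewrite /subword enum_setT -enumT map_tnth_enum.
Qed.

Lemma subtupleE I : subtuple w I = subword w I :> seq letter.
Proof. by rewrite -(subword_setT (subtuple w I)) subword_subtuple imset_enum_val. Qed.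

Lemma nconvex_subtuple I (J A : {set 'I_#|I|}) :
  nconvex (wtype (subtuple w I)) J A =
  nconvex (wtype w) (enum_val @: J) (enum_val @: A).
Proof. exact/nconvex_comp/enum_val_incr. Qed.

Lemma imset_ones_subtuple I :
  enum_val @: ones (wtype (subtuple w I)) = I :&: ones (wtype w).
Proof.
rewrite -[RHS](@imset_enum_valK I) ?subsetIl // ones_comp.
suff -> : @enum_val _ (mem I) @^-1: (I :&: ones (wtype w)) =
          enum_val @^-1: ones (wtype w) by [].
by apply/setP => k; rewrite [LHS]in_set [RHS]in_set in_setI enum_valP.
Qed.

Lemma ones_translucidate I :
  ones (wtype (translucidate w I)) = ones (wtype w) :\: I.
Proof.
apply/setP => i; rewrite !inE !tnth_mktuple.
by case: (i \in I).
Qed.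

Lemma nle_translucidate I i j :
  nle (wtype (translucidate w I)) i j = nle (wtype w) i j.
Proof. by rewrite /nle !tnth_mktuple; do 2 case: ifP => _. Qed.

Lemma nconvex_translucidate I J A :
  nconvex (wtype (translucidate w I)) J A = nconvex (wtype w) J A.
Proof.
apply: eq_forallb_in => i _; apply: eq_forallb_in => k _.
by apply: eq_forallb_in => j _; rewrite !nle_translucidate.
Qed.

Lemma subword_translucidate I A :
  [disjoint A & I] -> subword (translucidate w I) A = subword w A.
Proof.
move=> d; apply/eq_in_map => i; rewrite mem_enum => iA.
by rewrite tnth_mktuple (disjointFr d iA).
Qed.

End Subtuple.

(** * Values of the elements of m_I *)

Variable F : realType.
Implicit Types f g : linear_form SL SR F.

Lemma mI_value f n (w : n.-tuple letter) :
  in_mI f ->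
  f w = ((ones (wtype w) != set0) && nconvex (wtype w) setT (ones (wtype w)))%:R
        * f (subword w (ones (wtype w))).
Proof.
case=> _ f0 f1; case: andP => [/card_int_of e|nc].
  by rewrite mul1r -f1.
by rewrite mul0r f0 // => /card_int_of.
Qed.

Lemma mI_subword f n (w : n.-tuple letter) I A :
  in_mI f -> A = I :&: ones (wtype w) -> A != set0 ->
  f (subword w I) = (nconvex (wtype w) I A)%:R * f (subword w A).
Proof.
move=> fm eA A0; rewrite -subtupleE (mI_value (subtuple w I) fm).
rewrite nconvex_subtuple subword_subtuple imset_enum_val imset_ones_subtuple.
have -> : ones (wtype (subtuple w I)) != set0.
  by rewrite -(imset_eq0 (@enum_val _ (mem I))) imset_ones_subtuple -eA.
by rewrite -eA.
Qed.

Lemma mI_translucidate f n (w : n.-tuple letter) I B :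
  in_mI f -> B = ones (wtype w) :\: I -> B != set0 ->
  f (translucidate w I) = (nconvex (wtype w) setT B)%:R * f (subword w B).
Proof.
move=> fm eB B0; rewrite (mI_value _ fm) ones_translucidate -eB B0 /=.
rewrite nconvex_translucidate subword_translucidate //.
by rewrite eB disjoints_subset; apply/subsetP => i; rewrite !inE => /andP[].
Qed.

Lemma mI_nil f : in_mI f -> f [::] = 0.
Proof. by case=> f0 _ _; apply: f0. Qed.

(** Only the ones A of I matter, as I contains all zeros.  The Boolean b selects
between the two products. *)
Lemma sum_subwords f g n (w : n.-tuple letter) (m : 'I_n) b :
  let t := wtype w in
  in_mI f -> in_mI g -> m \in ones t ->
  \sum_(I : {set 'I_n} |
      [&& zeros t \proper I, I \proper [set: 'I_n] & (m \in I) == b])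
     f (subword w I) * g (translucidate w I) =
  \sum_(A : {set 'I_n} |
      [&& A \proper ones t, A != set0 & (m \in A) == b])
     (nconvex t (zeros t :|: A) A && nconvex t setT (ones t :\: A))%:R
     * (f (subword w A) * g (subword w (ones t :\: A))).
Proof.
move=> t fm gm mO.
have zO : zeros t = ~: ones t by apply/setP => i; rewrite in_onesN in_setC.
rewrite (reindex_onto (fun A => zeros t :|: A) (fun I => I :&: ones t)); last first.
  move=> I /and3P[/proper_sub zI _ _].
  rewrite setUIr zO [X in _ :&: X]setUC setUCr setIT.
  by apply/setUidPr; rewrite -zO.
have eA (A : {set 'I_n}) : A \subset ones t -> (zeros t :|: A) :&: ones t = A.
  by move=> AO; rewrite setIUl zO [X in X :|: _]setIC setICr set0U; apply/setIidPl.
have eB (A : {set 'I_n}) : ones t :\: (zeros t :|: A) = ones t :\: A.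
  by rewrite !setDE setCU zO setCK setIA setIid.
have sub (A : {set 'I_n}) : ((zeros t :|: A) :&: ones t == A) = (A \subset ones t).
  apply/eqP/idP => [<-|]; [exact: subsetIr | exact: eA].
have key (A : {set 'I_n}) :
    [&& zeros t \proper zeros t :|: A, zeros t :|: A \proper setT
               & (m \in zeros t :|: A) == b] && ((zeros t :|: A) :&: ones t == A)
             = [&& A \proper ones t, A != set0 & (m \in A) == b].
  rewrite sub; case AO: (A \subset ones t); last by rewrite (properE A) AO andbF.
  rewrite andbT !properE AO subsetUl subsetT in_setU zO in_setC mO /=.
  rewrite -subDset setTD setCK subUset subxx /= -disjoints_subset -setI_eq0.
  by rewrite (setIidPl AO) andbCA.
rewrite (eq_bigl _ _ key); apply: eq_bigr => A /and3P[AO A0 _].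
have AS := proper_sub AO.
rewrite (@mI_subword f _ w _ A) ?eA //.
rewrite (@mI_translucidate g _ w _ (ones t :\: A)) ?eB //.
  by rewrite mulrACA -natrM mulnb.
by rewrite setD_eq0; case/andP: AO.
Qed.

(** * The preLie product on m_I *)

(** The product [lprec] for b = true and [lsucc] for b = false, on a tuple of
any length n instead of a sequence seen as a tuple. *)
Definition side_sum f g n (w : n.-tuple letter) b : F[i] :=
  let t := wtype w in
  if nmin t (ones t) is Some m then
    \sum_(I : {set 'I_n} |
            [&& zeros t \proper I, I \proper [set: 'I_n] & (m \in I) == b])
      f (subword w I) * g (translucidate w I)
  else 0.

Lemma lprecE f g n (w : n.-tuple letter) : lprec f g w = side_sum f g w true.
Proof.
case: w => s sn; have e := eqP sn; subst n.
have -> : Tuple sn = in_tuple s by apply: val_inj.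
rewrite /lprec /side_sum /=; case: nmin => // m.
by apply: eq_bigl => I; rewrite eqb_id.
Qed.

Lemma lsuccE f g n (w : n.-tuple letter) : lsucc f g w = side_sum f g w false.
Proof.
case: w => s sn; have e := eqP sn; subst n.
have -> : Tuple sn = in_tuple s by apply: val_inj.
rewrite /lsucc /side_sum /=; case: nmin => // m.
by apply: eq_bigl => I; rewrite eqbF_neg.
Qed.

Lemma prelie_sum f g n (w : n.-tuple letter) m :
  let t := wtype w in
  in_mI f -> in_mI g -> nmin t (ones t) = Some m -> m \in ones t ->
  prelie f g w =
  \sum_(A : {set 'I_n} | (A \proper ones t) && (m \in A))
    ((nconvex t (zeros t :|: A) A && nconvex t setT (ones t :\: A))%:R
     - (nconvex t (zeros t :|: (ones t :\: A)) (ones t :\: A)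
        && nconvex t setT A)%:R)
    * (f (subword w A) * g (subword w (ones t :\: A))).
Proof.
move=> t fm gm em mO; rewrite /prelie lprecE lsuccE /side_sum -/t em.
rewrite !sum_subwords // -/t.
have KD (A : {set 'I_n}) : A \subset ones t -> ones t :\: (ones t :\: A) = A.
  by move=> AO; rewrite setDDr setDv set0U; apply/setIidPr.
(* The second sum is reindexed by complementation in the set of ones. *)
rewrite [X in _ - X](reindex_onto (fun A => ones t :\: A) (fun A => ones t :\: A));
  last by move=> A /and3P[/proper_sub/KD].
have k1 (A : {set 'I_n}) : [&& A \proper ones t, A != set0 & (m \in A) == true] =
            (A \proper ones t) && (m \in A).
  rewrite eqb_id; case mA: (m \in A); last by rewrite !andbF.
  by rewrite andbT; congr (_ && _); apply/set0Pn; exists m.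
have k2 (A : {set 'I_n}) : [&& ones t :\: A \proper ones t, ones t :\: A != set0
     & (m \in ones t :\: A) == false] && (ones t :\: (ones t :\: A) == A) =
            (A \proper ones t) && (m \in A).
  rewrite in_setD mO andbT eqbF_neg negbK.
  case mA: (m \in A); last by rewrite !andbF.
  have -> : (ones t :\: (ones t :\: A) == A) = (A \subset ones t).
    by apply/eqP/idP => [<-|/KD//]; apply: subsetDl.
  have -> : ones t :\: A \proper ones t.
    rewrite properE subsetDl /=; apply/subsetPn; exists m => //.
    by rewrite in_setD mA.
  by rewrite !andbT /= setD_eq0 andbC -properE.
rewrite (eq_bigl _ _ k1) (eq_bigl _ _ k2) -sumrB; apply: eq_bigr => A.
by case/andP => /proper_sub/KD-> _; rewrite mulrBl [g _ * f _]mulrC.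
Qed.

Lemma prelie_gap f g n (w : n.-tuple letter) :
  let t := wtype w in
  in_mI f -> in_mI g -> ~~ nconvex t setT (ones t) -> prelie f g w = 0.
Proof.
move=> t fm gm nO; have := nmin_spec t; case em: (nmin t (ones t)) => [m|].
  case=> mO _; rewrite (prelie_sum fm gm em mO) big1 // => A /andP[/proper_sub AO _].
  by rewrite gap_convexE // subrr mul0r.
by rewrite /prelie lprecE lsuccE /side_sum em subrr.
Qed.

Lemma prelie_no_ones f g n (w : n.-tuple letter) :
  ones (wtype w) = set0 -> prelie f g w = 0.
Proof.
move=> O0; have := nmin_spec (wtype w); rewrite /prelie lprecE lsuccE /side_sum.
by case: nmin => [m|_]; rewrite ?subrr // O0 => -[]; rewrite inE.
Qed.

Lemma prelie_interval f g n (w : n.-tuple letter) :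
  let t := wtype w in
  in_mI f -> in_mI g -> nconvex t setT (ones t) ->
  prelie f g w =
  \sum_(J : {set 'I_n} | [&& J \subset ones t, nconvex t setT J
                           & ~~ nconvex t setT (ones t :\: J)])
     f (subword w (ones t :\: J)) * g (subword w J).
Proof.
move=> t fm gm cO.
have [O0|O0] := eqVneq (ones t) set0.
  rewrite prelie_no_ones // big1 // => J /and3P[_ _].
  by rewrite O0 set0D nconvex0.
have := nmin_spec t; case em: (nmin t (ones t)) => [m|]; last first.
  by move=> e; rewrite e eqxx in O0.
case=> mO mle; rewrite (prelie_sum fm gm em mO) -/t.
have KD (A : {set 'I_n}) : A \subset ones t -> ones t :\: (ones t :\: A) = A.
  by move=> AO; rewrite setDDr setDv set0U; apply/setIidPr.
pose Q (A : {set 'I_n}) := nconvex t setT A.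
rewrite (eq_bigr (fun A => if Q (ones t :\: A) && ~~ Q A then
   f (subword w A) * g (subword w (ones t :\: A)) else 0)); last first.
  move=> A /andP[/proper_sub AO mA]; rewrite -mulrb -[RHS]mulr_natl; congr (_ * _).
  rewrite !nconvex_zerosU ?subsetDl //= -/(Q A) -/(Q (ones t :\: A)).
  case QA: (Q A); last by rewrite subr0 andbT.
  by rewrite [Q _](nconvex_compl cO mle mA QA) subrr.
rewrite -big_mkcondr.
(* The right-hand side is reindexed by A, the complement of J. *)
rewrite [RHS](reindex_onto (fun A => ones t :\: A) (fun A => ones t :\: A));
  last by move=> A /and3P[/KD].
apply: eq_big => [A|A]; last by case/andP=> /andP[/proper_sub/KD->].
rewrite subsetDl /= -!/(Q _).
have -> : (ones t :\: (ones t :\: A) == A) = (A \subset ones t).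
  by apply/eqP/idP => [<-|/KD//]; apply: subsetDl.
case AO: (A \subset ones t); last by rewrite properE AO andbF.
rewrite KD // andbT; case QB: (Q (ones t :\: A)); last by rewrite andbF.
case QA: (Q A); first by rewrite andbF.
(* It remains to see that A is proper and contains m automatically. *)
rewrite !andbT properE AO; apply/andP; split.
  apply/negP => OA; move: QA; rewrite /Q (_ : A = ones t) ?cO //.
  by apply/eqP; rewrite eqEsubset AO.
apply/negPn/negP => mA.
have : Q (ones t :\: (ones t :\: A)).
  by apply: (nconvex_compl cO mle) => //; rewrite in_setD mA.
by rewrite KD // QA.
Qed.

Lemma prelie_subword_ones f g n (w : n.-tuple letter) :
  let t := wtype w in
  in_mI f -> in_mI g -> nconvex t setT (ones t) ->
  prelie f g w = prelie f g (subword w (ones t)).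
Proof.
move=> t fm gm cO; rewrite -subtupleE.
set v := subtuple w (ones t); set h := @enum_val _ (mem (ones t)).
have hI : injective h := @enum_val_inj _ _.
have onesv : ones (wtype v) = setT.
  apply: (imset_inj hI); rewrite imset_ones_subtuple setIid.
  by rewrite [RHS]imset_enum_val.
have hO (X : {set 'I_#|ones t|}) : h @: X \subset ones t.
  by apply/subsetP => _ /imsetP[i _ ->]; apply: enum_valP.
have QE (X : {set 'I_#|ones t|}) :
    nconvex (wtype v) setT X = nconvex t setT (h @: X).
  by rewrite nconvex_subtuple imset_enum_val (nconvex_setT (hO X) cO).
rewrite !prelie_interval //; last first.
  by rewrite onesv; apply/nconvexP => i j k; rewrite !in_setT.
rewrite onesv.
rewrite (reindex_onto (fun X : {set 'I_#|ones t|} => h @: X) (fun A => h @^-1: A));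
  last by move=> A /and3P[AO _ _]; apply: imset_enum_valK.
have hD (X : {set 'I_#|ones t|}) : ones t :\: h @: X = h @: (setT :\: X).
  rewrite -{1}[ones t]imset_enum_val; apply/setP => i; rewrite in_setD.
  apply/andP/imsetP => [[iX /imsetP[k _ e]]|[k]].
    exists k => //; rewrite in_setD in_setT andbT.
    by apply: contra iX => kX; rewrite e imset_f.
  by rewrite in_setD => /andP[kX _] ->; rewrite mem_imset // kX imset_f.
apply: eq_big => [X|X _]; last by rewrite hD !subword_subtuple.
rewrite hO subsetT !QE hD /=.
have -> : h @^-1: (h @: X) == X; last by rewrite andbT.
by apply/eqP/setP => k; rewrite inE mem_imset.
Qed.

Lemma prelie_triples f g n (w : n.-tuple letter) :
  let t := wtype w in
  in_mI f -> in_mI g -> nconvex t setT (ones t) ->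
  prelie f g w =
     \sum_(I1 : {set 'I_n}) \sum_(J : {set 'I_n})
       \sum_(I2 : {set 'I_n} | ones_split t I1 J I2)
         f (subword w (I1 :|: I2)) * g (subword w J).
Proof.
move=> t fm gm cO; rewrite prelie_interval // -/t.
rewrite pair_big /= pair_big_dep /=.
(* The terms with J empty vanish. *)
rewrite [RHS](bigID (fun p => p.1.2 != set0)) /= [X in _ = _ + X]big1 ?addr0;
  last first.
  move=> p /andP[_ /negPn/eqP->].
  by rewrite /subword enum_set0 /= (mI_nil gm) mulr0.
rewrite [RHS](reindex_onto (fun J => (before t (ones t) J, J, after t (ones t) J))
  (fun p => p.1.2)) /=; last first.
  by move=> [[I1 J] I2] /= /andP[/ones_split_eq h /h[-> ->]].
apply: eq_big => [J|J]; first by rewrite eqxx andbT ones_split_before_after.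
rewrite -ones_split_before_after // => /andP[sp J0]; congr (f (subword w _) * _).
case/and5P: sp => _ _ _ _ /andP[/and3P[d1 d2 _] /eqP eO].
apply/setP => i; rewrite in_setD -[in LHS]eO !in_setU.
case iJ: (i \in J) => /=; last by rewrite orbF.
by rewrite (disjointFl d1 iJ) (disjointFr d2 iJ).
Qed.

End Words.

Theorem proposition5p3 (SL SR : finType) (F : realType) :
  (forall f g : linear_form SL SR F, in_mI f -> in_mI g -> in_mI (prelie f g))
  /\
  (forall (n : nat) (t : translucent n) (w : n.-tuple (letter SL SR)),
     incomplete t w -> #|int_of t| = 1%N ->
     forall f g : linear_form SL SR F, in_mI f -> in_mI g ->
     prelie f g w =
     \sum_(I1 : {set 'I_n}) \sum_(J : {set 'I_n})
       \sum_(I2 : {set 'I_n} | ones_split t I1 J I2)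
         f (subword w (I1 :|: I2)) * g (subword w J)).
Proof.
split=> [f g fm gm|n t w /incompleteE <- /card_int_of[_ cO] f g fm gm]; last first.
  exact: prelie_triples.
split=> [s ph|n w nc|n w /card_int_of[_ cO]].
- rewrite -[s]/(val (in_tuple s)) prelie_no_ones //.
  apply/setP => i; rewrite !in_set tnth_mktuple.
  have /all_tnthP phE : all (@is_placeholder SL SR) (in_tuple s) by [].
  by move: (phE i); case: (tnth _ i).
- have [O0|O0] := eqVneq (ones (wtype w)) set0; first exact: prelie_no_ones.
  by apply: prelie_gap => //; apply/negP => cO; apply: nc; apply/card_int_of.
- exact: prelie_subword_ones.
Qed.
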